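(* Let $\langle X,\|\cdot\|\rangle$ be a Banach space and let $A\subset X$ be a Suslin set. Then for every separable subspace $V_0\subset X$ there exists a closed separable subspace $V\subset X$ such that $V_0\subset V$ and (i) $A$ is $\sigma$-upper porous (in $X$) if and only if $A\cap V$ is $\sigma$-upper porous in the space $V$; (ii) $A$ is $\sigma$-lower porous (in $X$) if and only if $A\cap V$ is $\sigma$-lower porous in the space $V$.
   Context: Banach spaces are over the real numbers; ''subspace'' means linear subspace, and $V$ carries the restricted norm. A Suslin set is a set obtained from closed sets by the Suslin operation. $U(x,r)$ denotes the open ball $\{y:\rho(x,y)<r\}$. For a metric space $\langle Y,\rho\rangle$, a set $B\subset Y$, $x\in Y$ and $R>0$, let $\gamma(x,R,B)$ be the supremum of all $r\ge 0$ for which there exists $z\in Y$ with $U(z,r)\subset U(x,R)\setminus B$ (balls taken in $Y$). The set $B$ is upper porous at $x$ in $Y$ if $\limsup_{R\to0^+}\gamma(x,R,B)/R>0$, and lower porous at $x$ in $Y$ if $\liminf_{R\to0^+}\gamma(x,R,B)/R>0$. $B$ is upper porous (lower porous) in $Y$ if it is so at each of its points, and $\sigma$-upper porous ($\sigma$-lower porous) in $Y$ if it is a countable union of sets that are upper porous (lower porous) in $Y$. In a normed space these notions refer to the norm metric. *)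

(* Defs.v *)
From HB Require Import structures.
From mathcomp Require Import all_boot all_order all_algebra.
From mathcomp Require Import all_classical all_reals all_analysis.
Set Implicit Arguments.
Unset Strict Implicit.
Unset Printing Implicit Defensive.
Import Order.TTheory GRing.Theory Num.Theory.
Import numFieldNormedType.Exports.
Local Open Scope classical_set_scope.
Local Open Scope ring_scope.

Definition separable (T : topologicalType) : Prop :=
  exists2 D : set T, countable D & dense D.

(* [mkseq u n.+1] is the initial segment [:: u 0; ...; u n]; the value of the
   scheme [F] at the empty sequence is irrelevant. *)
Definition suslin (T : topologicalType) (A : set T) : Prop :=
  exists2 F : seq nat -> set T, (forall s, closed (F s)) &
    A = \bigcup_(u in [set: nat -> nat]) \bigcap_n F (mkseq u n.+1).

(* Porosity is expressed with the library's [ball], which is the open ball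
   U(x, r) both in a normed module ([ball_normE]) and in a subset of it with
   the restricted norm ([set_type_ballE] below). *)
Section porosity.
Variables (R : realType) (Y : pseudoMetricType R).
Implicit Types (x : Y) (B : set Y).

(* The supremum is taken in the extended reals: it may be infinite when [Y] is
   bounded. *)
Definition porosity_radius x (s : R) B : \bar R :=
  ereal_sup [set r%:E | r in
    [set r : R | 0 <= r /\ exists z : Y, ball z r `<=` ball x s `\` B]].

Definition upper_porous_at x B : Prop :=
  (0 < limf_esup (fun s : R => porosity_radius x s B * (s^-1)%:E) 0^'+)%E.

Definition lower_porous_at x B : Prop :=
  (0 < limf_einf (fun s : R => porosity_radius x s B * (s^-1)%:E) 0^'+)%E.

Definition upper_porous B : Prop := forall x, B x -> upper_porous_at x B.

Definition lower_porous B : Prop := forall x, B x -> lower_porous_at x B.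

Definition sigma_upper_porous B : Prop :=
  exists2 C : nat -> set Y, (forall n, upper_porous (C n)) & B = \bigcup_n C n.

Definition sigma_lower_porous B : Prop :=
  exists2 C : nat -> set Y, (forall n, lower_porous (C n)) & B = \bigcup_n C n.

End porosity.

Lemma set_type_ballE (R : realType) (X : normedModType R) (V : set X)
    (v : set_type V) (r : R) :
  ball v r = [set w : set_type V | `|set_val v - set_val w| < r].
Proof. by rewrite -initial_ballE -ball_normE. Qed.

(* Main.v *)
Require Import Defs.
From HB Require Import structures.
From mathcomp Require Import all_boot all_order all_algebra.
From mathcomp Require Import all_classical all_reals all_analysis.
From mathcomp Require Import wochoice lra.
Set Implicit Arguments.
Unset Strict Implicit.
Unset Printing Implicit Defensive.
Import Order.TTheory GRing.Theory Num.Theory.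
Import numFieldNormedType.Exports.
Local Open Scope classical_set_scope.
Local Open Scope ring_scope.

(* Porosity is tested at dyadic scales: B is porous at x iff, for some i, at
   infinitely many scales (upper) or all small scales (lower) 2^-k a ball of
   radius 2^-(i + k) missing B has its centre within 2^-k of x. The set where
   this fails is a countable intersection of countable unions of closed sets.

   V is the closure of a countable set D closed under countably many choice
   functions. If A is sigma-porous in X, D is closed under the choice of centres
   of holes in the pieces of A, so the holes are visible in V. If A is not
   sigma-porous, sets that are nowhere sigma-porous are cut out of A by balls
   with centre in D: each new set lies in a smaller Suslin piece, consists of
   nonporosity points of the previous ones, and lies in ever more of the closed
   sets that witness this nonporosity. D meets all these sets, and a Baire
   category argument inside V (Foran's lemma) produces a point of A that avoids
   any given countable family of porous subsets of V. That a set which is not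
   sigma-porous contains a nowhere sigma-porous one needs that local
   sigma-porosity implies sigma-porosity, also in nonseparable spaces. *)

(** * Well-orderings, dyadic scales and rational radii *)

Lemma well_order_exists (T : eqType) : exists le : T -> T -> Prop,
  [/\ forall x y, le x y \/ le y x, forall x y, le x y -> le y x -> x = y &
      forall P : T -> Prop, (exists x, P x) ->
        exists2 z, P z & forall y, P y -> le z y].
Proof.
have [le wole] := well_ordering_principle T; exists (fun x y => le x y).
have minP (P : T -> Prop) : (exists x, P x) ->
    exists2 z, P z & forall y, P y -> le z y.
  move=> [x Px]; have [|z [[zP zmin] _]] := wole [pred x | `[< P x >]].
    by exists x; apply/asboolP.
  by exists z => [|y Py]; [exact/asboolP | apply/zmin/asboolP].
split=> [x y|x y lexy leyx|//].
  have [|z [->|->] zmin] := minP (fun z => z = x \/ z = y).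
  - by exists x; left.
  - by left; apply: zmin; right.
  - by right; apply: zmin; left.
have wole' : wo_chain le predT by move=> A _; exact: wole.
by apply: (wo_chain_antisymmetric wole'); rewrite ?lexy.
Qed.

Section geometric_scale.
Variable R : realType.

Definition eps (k : nat) : R := 2^-1 ^+ k.

Lemma eps_gt0 k : 0 < eps k.
Proof. by rewrite exprn_gt0. Qed.

Lemma epsS k : eps k = eps k.+1 + eps k.+1.
Proof. by rewrite /eps exprS; lra. Qed.

Lemma epsD m k : eps (m + k) = eps m * eps k.
Proof. exact: exprD. Qed.

Lemma eps_le m k : (m <= k)%N -> eps k <= eps m.
Proof.
move=> mk; apply: ler_wiXn2l => //; lra.
Qed.

Lemma eps_small (r : R) : 0 < r -> exists k, eps k < r.
Proof.
move=> r0; have [k _] := near_infty_natSinv_expn_lt (PosNum r0).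
by move=> /(_ k (leqnn k)) /=; rewrite div1r -exprVn; exists k.
Qed.

Lemma eps_ge0 k : 0 <= eps k.
Proof. exact: ltW (eps_gt0 k). Qed.

(** Coded radii let a ball be given by its centre and a natural number; negative values give empty
    balls. *)
Definition qrad (a : nat) : R := ratr (odflt 0%Q (unpickle a)).

Lemma qrad_dense (x y : R) : x < y -> exists a, x < qrad a < y.
Proof.
move=> /rat_in_itvoo [q]; rewrite in_itv /= => qxy.
by exists (pickle q); rewrite /qrad pickleK.
Qed.

End geometric_scale.
Arguments eps {R} k.
Arguments qrad {R} a.

(** * Porosity and sigma-porosity at dyadic scales *)

(* Throughout, [b = true] stands for upper and [b = false] for lower porosity. *)
Definition frequent (b : bool) (P : nat -> Prop) : Prop :=
  if b then forall j, exists2 k, (j <= k)%N & P k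
  else exists j, forall k, (j <= k)%N -> P k.

Lemma frequent_mono b N (P Q : nat -> Prop) :
  (forall k, (N <= k)%N -> P k -> Q k) -> frequent b P -> frequent b Q.
Proof.
case: b => PQ /= => [fP j|[j fP]].
  have [k] := fP (maxn N j); rewrite geq_max => /andP[Nk jk] Pk.
  by exists k => //; exact: PQ.
exists (maxn N j) => k; rewrite geq_max => /andP[Nk jk].
by apply: PQ => //; exact: fP.
Qed.

Section porous.
Variables (R : realType) (X : normedModType R).
Implicit Types (V B E : set X) (x y z : X) (b : bool).

(* The ambient space is the subset [V] of [X]; [B] need not be included in it. *)
Definition hole V (m k : nat) B : set X :=
  [set x | exists2 z, V z &
     `|x - z| < eps k /\ forall y, B y -> ~ `|z - y| < eps (m + k) ].

(* The closed sets whose unions over [j] have as intersection over [i] the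
   nonporosity points of [B], see [not_porP]. *)
Definition solid V b (i j : nat) B : set X :=
  if b then [set x | forall k, (j <= k)%N -> ~ hole V i k B x]
  else [set x | (i <= j)%N /\ ~ hole V i j B x].

Definition por V b B x : Prop := exists i, forall j, ~ solid V b i j B x.

Definition spor V b E : Prop :=
  exists2 C : nat -> set X, (forall n x, C n x -> por V b (C n) x) &
    E `<=` \bigcup_n C n.

Lemma hole_sub V m k B B' : B `<=` B' -> hole V m k B' `<=` hole V m k B.
Proof. by move=> BB' x [z Vz [xz zB]]; exists z => //; split=> // y /BB'/zB. Qed.

Lemma hole_homo V m m' k B :
  (m <= m')%N -> hole V m k B `<=` hole V m' k B.
Proof.
move=> mm' x [z Vz [xz zB]]; exists z => //; split=> // y By zy.
by apply: (zB y By); apply: lt_le_trans zy _; rewrite eps_le// leq_add2r.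
Qed.

(** Holes are easier to find as their first index grows, so for lower porosity the ratio and the
    threshold scale merge into one index, their maximum. *)
Lemma porP V b B x :
  por V b B x <-> exists i, frequent b (fun k => hole V i k B x).
Proof.
case: b => /=; split.
- move=> [i iB]; exists i => j; apply/not_exists2P => h; apply: (iB j) => k jk hk.
  by case: (h k).
- move=> [i iB]; exists i => j; have [k jk hk] := iB j; by move=> /(_ k jk).
- move=> [i iB]; exists i, i => j ij; apply: contrapT => h; exact: (iB j).
- move=> [i [j0 h]]; exists (maxn i j0) => j [].
  rewrite geq_max => /andP[ij jj]; apply; apply: hole_homo (h _ jj).
  by rewrite leq_maxl.
Qed.

Lemma por_hole V V' b B B' x :
  (forall m k, hole V m k B x -> hole V' m k B' x) -> por V b B x ->
  por V' b B' x.
Proof.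
by move=> h /porP[i iB]; apply/porP; exists i; apply: (frequent_mono (N := 0)) iB => k _; exact: h.
Qed.

Lemma por_sub V b B B' x : B `<=` B' -> por V b B' x -> por V b B x.
Proof. by move=> BB'; apply: por_hole => m k; exact: hole_sub. Qed.

(** At a scale [k > N] both the distance from [x] to the centre and the radius of the hole are at
    most [eps N.+1], so the hole stays within [eps N] of [x]. *)
Lemma por_local V b B B' x N :
  (forall y, B y -> `|x - y| < eps N -> B' y) -> por V b B' x -> por V b B x.
Proof.
move=> BB' /porP[i iB]; apply/porP; exists i; apply: (frequent_mono (N := N.+1) _ iB).
move=> k Nk [z Vz [xz zB]]; exists z => //; split=> // y By zy.
apply: (zB y _ zy); apply: BB' => //.
have := ler_distD z x y; have := @eps_le R _ _ Nk; have := epsS R N.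
have := @eps_le R _ _ (leq_addl i k); lra.
Qed.

Lemma solid_mono V b i i' j B B' : (i <= i')%N -> B `<=` B' ->
  solid V b i' j B `<=` solid V b i j B'.
Proof.
move=> ii' BB'; have hh k x : hole V i k B' x -> hole V i' k B x.
  by move=> h; apply/(hole_homo ii')/(hole_sub BB').
case: b => x /= => [h k jk /hh|[ij h]]; first exact: h.
by split; [exact: leq_trans ij|move=> /hh].
Qed.

Lemma not_porP V b B x : ~ por V b B x <-> forall i, exists j, solid V b i j B x.
Proof.
split=> [nB i|nB [i iB]]; last by have [j] := nB i; exact: iB.
by apply: contrapT => /forallNP h; apply: nB; exists i.
Qed.

(** The centre of a hole at [x] also serves all nearby points, so [hole] is open. *)
Lemma solid_closed V b i j B : closed (solid V b i j B).
Proof.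
have hole_open m k : open (hole V m k B).
  rewrite openE => x [z Vz [xz zB]]; rewrite /interior.
  apply/nbhs_ballP; exists (eps k - `|x - z|); first by rewrite /= subr_gt0.
  move=> y; rewrite -ball_normE /= => xy; exists z => //; split=> //.
  by have := ler_distD x y z; rewrite (distrC y x); lra.
case: b => /=.
  rewrite (_ : [set _ | _] = \bigcap_(k in [set k | (j <= k)%N]) ~` hole V i k B).
    by apply: closed_bigI => k _; apply: open_closedC.
  by apply/seteqP; split=> x /= h k; exact: h.
have [ij|ij] := boolP (i <= j)%N.
  rewrite (_ : [set _ | _] = ~` hole V i j B); first exact: open_closedC.
  by apply/seteqP; split=> x /= => [[]|].
rewrite (_ : [set _ | _] = set0); first exact: closed0.
by apply/seteqP; split=> x //= [].
Qed.

Lemma spor_sub V b E E' : E `<=` E' -> spor V b E' -> spor V b E.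
Proof. by move=> EE' [C Cpor CE]; exists C => // x /EE'/CE. Qed.

Lemma spor_por V b E : (forall x, E x -> por V b E x) -> spor V b E.
Proof. by move=> Epor; exists (fun=> E) => // x Ex; exists 0%N. Qed.

Lemma spor_bigcup V b (T : countType) (F : T -> set X) :
  (forall n, spor V b (F n)) -> spor V b (\bigcup_n F n).
Proof.
move=> sF; have /choice[C CP] : forall n, exists C : nat -> set X,
    (forall m x, C m x -> por V b (C m) x) /\ F n `<=` \bigcup_m C m.
  by move=> n; have [C C1 C2] := sF n; exists C.
exists (fun p => if unpickle p is Some (n, m) then C n m else set0).
  by move=> p x; case: (unpickle p) => // -[n m]; have [h _] := CP n; exact: h.
move=> x [n _ Fx]; have [_ /(_ x Fx)[m _ Cx]] := CP n.
by exists (pickle (n, m)) => //=; rewrite pickleK.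
Qed.

Lemma spor_setU V b E E' : spor V b E -> spor V b E' -> spor V b (E `|` E').
Proof.
move=> sE sE'; apply: (@spor_sub _ _ _ (\bigcup_(c : bool) if c then E else E')).
  by move=> x [Ex|Ex]; [exists true|exists false].
by apply: spor_bigcup => -[].
Qed.

Lemma spor_bigcupN V b (T : countType) (F : T -> set X) E :
  E `<=` \bigcup_n F n -> ~ spor V b E -> exists n, ~ spor V b (E `&` F n).
Proof.
move=> EF nE; apply: contrapT => /forallNP h; apply: nE.
apply: (@spor_sub _ _ _ (\bigcup_n (E `&` F n))).
  by move=> x Ex; have [n _ Fx] := EF x Ex; exists n.
by apply: spor_bigcup => n; exact: contrapT.
Qed.

(** * Local sigma-porosity and the nowhere sigma-porous kernel *)

(* Stone's sigma-discrete refinement: [a y] is the least centre of a ball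
   containing [y], and two points well inside the balls of their centres have
   the same centre as soon as they are close. *)
Lemma spor_uniform V b r E :
  0 < r -> (forall x, E x -> spor V b (E `&` [set y | `|x - y| < r])) ->
  spor V b E.
Proof.
move=> r0 Eloc; have [le [letot leanti lemin]] := well_order_exists X.
have /choice[a aP] : forall y, exists z, E y ->
    [/\ E z, `|z - y| < r & forall x, E x -> `|x - y| < r -> le z x].
  move=> y; have [Ey|nEy] := pselect (E y); last by exists y.
  have [|z [Ez zy] zmin] := lemin (fun z => E z /\ `|z - y| < r).
    by exists y; rewrite subrr normr0.
  by exists z => _; split=> // x Ex xy; apply: zmin.
have /choice[C CP] : forall x, exists C : nat -> set X, E x ->
    (forall m y, C m y -> por V b (C m) y) /\
    E `&` [set y | `|x - y| < r] `<=` \bigcup_m C m.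
  move=> x; have [Ex|nEx] := pselect (E x); last by exists (fun=> set0).
  by have [C C1 C2] := Eloc x Ex; exists C.
(* Piece [(k, m)]: points at depth at least [eps k] in the ball of their least centre and in the
   [m]-th porous set of that centre. *)
pose W (p : nat * nat) :=
  [set y | [/\ E y, `|a y - y| + eps p.1 <= r & C (a y) p.2 y]].
apply: (@spor_sub _ _ _ (\bigcup_p W p)).
  move=> y Ey; have [Ea ay _] := aP y Ey.
  have [_ /(_ y)] := CP _ Ea; case=> // m _ Cm.
  have [|k hk] := @eps_small R (r - `|a y - y|); first by rewrite subr_gt0.
  by exists (k, m) => //; split=> //=; lra.
apply: spor_bigcup => -[k m]; apply: spor_por => y [/= Ey ay Cy].
have [Ea _ _] := aP y Ey; have [/(_ m y Cy) + _] := CP _ Ea.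
apply: (@por_local _ _ _ _ _ k) => y' [/= Ey' ay' Cy'] yy'.
suff -> : a y = a y' by [].
have [Ea' _ a'min] := aP y' Ey'; have [_ _ amin] := aP y Ey.
have [leaa'|lea'a] := letot (a y) (a y').
  apply: leanti => //; apply: a'min => //.
  by have := ler_distD y (a y) y'; lra.
apply: leanti => //; apply: amin => //.
by have := ler_distD y' (a y') y; rewrite (distrC y' y); lra.
Qed.

(** Sorting the points by a dyadic radius that works for them gives countably many pieces with a
    uniform radius. *)
Lemma spor_local V b E :
  (forall x, E x -> exists2 r, 0 < r & spor V b (E `&` [set y | `|x - y| < r])) ->
  spor V b E.
Proof.
move=> Eloc; pose F n := [set x | E x /\ spor V b (E `&` [set y | `|x - y| < eps n])].
apply: (@spor_sub _ _ _ (\bigcup_n F n)).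
  move=> x Ex; have [r r0 xr] := Eloc x Ex; have [n nr] := eps_small r0.
  exists n => //; split=> //; apply: spor_sub xr => y [Ey /= yn]; split=> //=.
  exact: lt_trans nr.
apply: spor_bigcup => n; apply: (@spor_uniform _ _ (eps n)); first exact: eps_gt0.
by move=> x [Ex]; apply: spor_sub => y [[Ey _] yn]; split.
Qed.

Definition spor_kernel V b E : set X :=
  [set x | E x /\ forall r, 0 < r -> ~ spor V b (E `&` [set y | `|x - y| < r])].

Definition nowhere_spor V b E : Prop :=
  forall x r, (E `&` [set y | `|x - y| < r]) !=set0 ->
    ~ spor V b (E `&` [set y | `|x - y| < r]).

Lemma spor_kernel_sub V b E : spor_kernel V b E `<=` E.
Proof. by move=> x []. Qed.

Lemma spor_setD_kernel V b E : spor V b (E `\` spor_kernel V b E).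
Proof.
apply: spor_local => x [Ex /not_andP[//|/existsNP[r /not_implyP[r0 /contrapT xr]]]].
by exists r => //; apply: spor_sub xr => y [[Ey _] yr].
Qed.

Lemma spor_kernel_neq0 V b E : ~ spor V b E -> spor_kernel V b E !=set0.
Proof.
move=> nE; apply/set0P/eqP => K0; apply: nE.
by have := spor_setD_kernel V b E; rewrite K0 setD0.
Qed.

(** If the kernel were sigma-porous in a ball containing one of its points, adding the sigma-porous
    rest of [E] would make [E] sigma-porous near that point. *)
Lemma spor_kernel_nowhere_spor V b E : nowhere_spor V b (spor_kernel V b E).
Proof.
move=> x r [y [[Ey ny] /= xy]] sK; apply: (ny (r - `|x - y|)).
  by rewrite subr_gt0.
apply: (@spor_sub _ _ _ ((spor_kernel V b E `&` [set y | `|x - y| < r]) `|`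
    (E `\` spor_kernel V b E))).
  move=> z [Ez /= yz]; have [Kz|nKz] := pselect (spor_kernel V b E z); last by right.
  by left; split=> //=; have := ler_distD y x z; lra.
by apply: spor_setU => //; exact: spor_setD_kernel.
Qed.

End porous.

(** * Dyadic holes against the suprema that define porosity *)

Lemma eps_bracket (R : realType) (s : R) j : 0 < s -> s <= eps j ->
  exists2 k, (j <= k)%N & eps k.+1 <= s <= eps k.
Proof.
move=> s0 sj; have [n ns] := eps_small s0.
have ex : exists k, eps k.+1 <= s.
  by exists n; apply: le_trans (ltW ns); exact: eps_le.
case: (ex_minnP ex) => k ks kmin.
have [kj|jk] := leqP k j; last first.
  exists k; first exact: ltnW.
  rewrite ks /= leNgt; apply/negP => sk.
  case: k jk sk kmin {ks} => // k jk sk /(_ k (ltW sk)); by rewrite ltnn.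
by exists j => //; rewrite sj (le_trans _ ks)// eps_le.
Qed.

Lemma at_right0P (R : realType) (W : set R) :
  0^'+ W <-> exists2 d : R, 0 < d & forall s, 0 < s -> s < d -> W s.
Proof.
split=> [/nbhs_ballP[d /= d0 dW]|[d d0 dW]].
  exists d => // s s0 sd; apply: (dW s) => //.
  by rewrite -ball_normE /= sub0r normrN gtr0_norm.
apply/nbhs_ballP; exists d => //= s; rewrite -ball_normE /= sub0r normrN => sd s0.
by apply: dW => //; rewrite gtr0_norm in sd.
Qed.

Lemma lt0_ereal_fin (R : realType) (x : \bar R) :
  (0 < x)%E -> exists2 c : R, 0 < c & (c%:E < x)%E.
Proof.
case: x => [r||//]; last by exists 1; rewrite ?ltry.
by rewrite lte_fin => r0; exists (r / 2); rewrite ?lte_fin; lra.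
Qed.

Section porosity_hole.
Variables (R : realType) (X : normedModType R) (Y : pseudoMetricType R).
Variable f : Y -> X.
Hypothesis f_ball : forall y r w, ball y r w <-> `|f y - f w| < r.
Implicit Types (y : Y) (B : set Y).

Lemma hole_porosity_radius m k s y B :
  hole (range f) m k (f @` B) (f y) -> eps k + eps k <= s ->
  s <= 4 * eps k ->
  ((eps m.+2)%:E <= porosity_radius y s B * (s^-1)%:E)%E.
Proof.
move=> [_ [z _ <-] [yz zB]] ks sk; have k0 := @eps_gt0 R k.
have s0 : 0 < s by lra.
rewrite lee_pdivlMr//; apply: (@le_trans _ _ (eps (m + k))%:E).
  rewrite lee_fin epsD -addn2 epsD -mulrA ler_pM2l ?eps_gt0//.
  by rewrite /(eps 2) expr2; lra.
apply: ereal_sup_ubound; exists (eps (m + k)) => //; split; first exact: eps_ge0.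
exists z => w /f_ball zw; split; last by move=> Bw; apply: (zB (f w)) => //; exists w.
apply/f_ball; have := ler_distD (f z) (f y) (f w).
have := @eps_le R _ _ (leq_addl m k); lra.
Qed.

(** A ball of radius [r > c * s > 0] contains its centre, which is thus within [s <= eps k] of [y];
    and [c * s] is at least [2 * eps m * eps k.+1 = eps (m + k)]. *)
Lemma porosity_radius_hole c m k s y B :
  0 < c -> (c%:E < porosity_radius y s B * (s^-1)%:E)%E ->
  0 < s -> eps k.+1 <= s <= eps k -> eps m + eps m <= c ->
  hole (range f) m k (f @` B) (f y).
Proof.
move=> c0 + s0 /andP[ks sk] mc; rewrite lte_pdivlMr// -EFinM => /ereal_sup_gt.
move=> [_ [r [r0 [z zP]] <-]]; rewrite lte_fin => csr.
have zz w : `|f z - f w| < r -> `|f y - f w| < s /\ ~ B w.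
  by move=> /f_ball/zP[/f_ball].
have cs0 : 0 < c * s by rewrite mulr_gt0.
exists (f z); first by exists z.
have [|yz _] := zz z; first by rewrite subrr normr0; lra.
split; first exact: lt_le_trans sk.
move=> _ [w Bw <-] zw; have [] := zz w => //; apply: lt_trans zw _.
apply: le_lt_trans csr; apply: le_trans (ler_wpM2l (ltW c0) ks).
rewrite epsD (epsS R k) mulrDr -mulrDl ler_wpM2r ?eps_ge0//.
Qed.

Lemma upper_porous_atP y B :
  upper_porous_at y B <-> por (range f) true (f @` B) (f y).
Proof.
rewrite porP /upper_porous_at /limf_esup; split.
  move=> /lt0_ereal_fin[c c0 cinf].
  have [m mc] : exists m, eps m < c / 2 by apply: eps_small; lra.
  exists m => j; pose W := [set s : R | 0 < s <= eps j].
  have W0 : 0^'+ W.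
    by apply/at_right0P; exists (eps j); [exact: eps_gt0|move=> s s0 /ltW sj; apply/andP].
  have := lt_le_trans cinf (ereal_inf_lbound (imageP _ W0)).
  move=> /ereal_sup_gt[_ [s /andP[s0 sj] <-] cs].
  have [k jk ksk] := eps_bracket s0 sj; exists k => //.
  by apply: porosity_radius_hole c0 cs s0 ksk _; lra.
move=> [m mB]; apply: (@lt_le_trans _ _ (eps m.+2)%:E).
  by rewrite lte_fin eps_gt0.
apply: le_ereal_inf_tmp => _ [W /at_right0P[d d0 dW] <-].
have [j jd] : exists j, eps j < d / 2 by apply: eps_small; lra.
have [k jk hk] := mB j; have := @eps_le R _ _ jk; have k0 := @eps_gt0 R k => kj.
apply: le_trans (ereal_sup_ubound _); last first.
  by apply: imageP; apply: (dW (eps k + eps k)); lra.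
by apply: hole_porosity_radius hk _ _; lra.
Qed.

Lemma lower_porous_atP y B :
  lower_porous_at y B <-> por (range f) false (f @` B) (f y).
Proof.
rewrite porP /lower_porous_at limf_einfE; split.
  move=> /lt0_ereal_fin[c c0 /ereal_sup_gt[_ [W /at_right0P[d d0 dW] <-] cW]].
  have [m mc] : exists m, eps m < c / 2 by apply: eps_small; lra.
  have [j jd] := eps_small d0; exists m, j => k jk.
  have k0 := @eps_gt0 R k; have kj := @eps_le R _ _ jk.
  apply: (porosity_radius_hole (c := c) (s := eps k)) => //; last lra.
    apply: (lt_le_trans cW); apply: ereal_inf_lbound; apply: imageP.
    by apply: dW => //; lra.
  by rewrite lexx eps_le.
move=> [m [j mB]]; apply: (@lt_le_trans _ _ (eps m.+2)%:E).
  by rewrite lte_fin eps_gt0.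
have j0 := @eps_gt0 R j; pose W := [set s : R | 0 < s < eps j + eps j].
have W0 : 0^'+ W.
  by apply/at_right0P; exists (eps j + eps j) => [|s s0 sj]; [lra|apply/andP].
apply: le_trans (ereal_sup_ubound (imageP _ W0)).
apply: le_ereal_inf_tmp => _ [s /andP[s0 sj] <-].
(* Bracketing [s / 2] puts [s] between [2 * eps k.+1] and [4 * eps k.+1], so the hole at scale
   [k.+1] is the one to use. *)
have [||k jk /andP[ks sk]] := @eps_bracket R (s / 2) j; [lra..|].
rewrite (epsS R k) in sk.
by apply: hole_porosity_radius (mB _ (leqW jk)) _ _; lra.
Qed.

Lemma porous_spor (P : Y -> set Y -> Prop) b B :
  (forall y B, P y B <-> por (range f) b (f @` B) (f y)) ->
  (exists2 C : nat -> set Y, (forall n y, C n y -> P y (C n)) & B = \bigcup_n C n)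
  <-> spor (range f) b (f @` B).
Proof.
move=> PP; split=> [[C Cpor ->]|[C Cpor BC]].
  exists (fun n => f @` C n).
    by move=> n _ [y Cy <-]; apply/PP; exact: Cpor.
  by move=> _ [y [n _ Cy] <-]; exists n => //; exists y.
exists (fun n => B `&` f @^-1` C n).
  move=> n y [By Cy]; apply/PP; apply: por_sub (Cpor n _ Cy).
  by move=> _ [w [_ Cw] <-].
apply/seteqP; split=> [y By|y [n _ []//]].
by have [n _ Cn] := BC _ (imageP f By); exists n.
Qed.

Lemma sigma_upper_porousP B :
  sigma_upper_porous B <-> spor (range f) true (f @` B).
Proof. by apply: porous_spor => y B'; exact: upper_porous_atP. Qed.

Lemma sigma_lower_porousP B :
  sigma_lower_porous B <-> spor (range f) false (f @` B).
Proof. by apply: porous_spor => y B'; exact: lower_porous_atP. Qed.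

End porosity_hole.

(** * Closures, balls with coded radii and nested balls *)

Section closure_norm.
Variables (R : realType) (X : normedModType R).

Lemma closure_normP (E : set X) x :
  closure E x <-> forall e, 0 < e -> exists2 y, E y & `|x - y| < e.
Proof.
split=> [cEx e e0|h W /nbhs_ballP[e /= e0 eW]].
  have [|y [Ey]] := cEx (ball x e); first exact: nbhsx_ballx.
  by rewrite -ball_normE /=; exists y.
by have [y Ey xy] := h e e0; exists y; split=> //; apply: eW; rewrite -ball_normE.
Qed.

(** Shrinks a ball around a point of the closure to one with centre in [D] and coded radius that
    still contains [z]; a countable [D] has only countably many of these. *)
Lemma closure_rad_ball (D : set X) x z r : closure D x -> `|x - z| < r ->
  exists d a, [/\ D d, `|d - z| < qrad a &
    forall y, `|d - y| < qrad a -> `|x - y| < r].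
Proof.
move=> /closure_normP Dx xz; pose e := r - `|x - z|.
have e0 : 0 < e by rewrite subr_gt0.
have [|a /andP[a1 a2]] := @qrad_dense R (`|x - z| + e / 3) (`|x - z| + e / 2).
  by lra.
have [|d Dd xd] := Dx (e / 3); first lra.
exists d, a; split=> // [|y dy].
  by have := ler_distD x d z; rewrite (distrC d x); lra.
by have := ler_distD d x y; rewrite /e in a2 xd; lra.
Qed.

End closure_norm.

(** Cantor's intersection theorem for closed balls; completeness enters here. *)
Lemma nested_balls (R : realType) (X : completeNormedModType R)
    (c : nat -> X) (r : nat -> R) :
  (forall n, 0 <= r n <= eps n) ->
  (forall n y, `|c n.+1 - y| <= r n.+1 -> `|c n - y| <= r n) ->
  exists x, forall n, `|c n - x| <= r n.
Proof.
move=> rn cn; have nest n m y : (n <= m)%N -> `|c m - y| <= r m -> `|c n - y| <= r n.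
  by move=> /subnK <-; elim: (m - n)%N => // i IH /cn.
have cc n m : (n <= m)%N -> `|c n - c m| <= r n.
  by move=> nm; apply: (nest n m) => //; rewrite subrr normr0; have /andP[] := rn m.
have : cvg (c @ \oo).
  apply/cauchy_cvgP/cauchyP => e e0; have [n ne] := eps_small e0.
  exists (c n); exists n => // m /= nm; rewrite -ball_normE /=.
  by have := cc _ _ nm; have /andP[_] := rn n; lra.
move=> cvgc; exists (lim (c @ \oo)) => n; apply/ler_addgt0Pr => e e0.
have /cvgrPdist_lt/(_ e e0)[N _ NP] := cvgc.
have := NP (maxn n N); rewrite /= leq_maxr => /(_ isT).
have := cc _ _ (leq_maxl n N).
by have := ler_distD (c (maxn n N)) (c n) (lim (c @ \oo)); rewrite (distrC (lim _)); lra.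
Qed.

(** * Descent of sigma-porosity to a closure *)

(** The number codes parameters, so one [Phi] stands for countably many finitary functions. *)
Definition closed_under (X : eqType) (Phi : nat -> seq X -> X) (D : set X) :=
  forall k xs, (forall x, x \in xs -> D x) -> D (Phi k xs).

Section reflection.
Variables (R : realType) (X : normedModType R) (b : bool).

(** [Phi] chooses centres of holes in the pieces [C n]. The centre of a hole at a point of the
    closure lies in a small ball with centre in [D] and coded radius; the centre chosen in that ball
    is in [D] and serves instead. *)
Lemma spor_reflection (A : set X) : spor setT b A ->
  exists Phi, forall D, closed_under Phi D ->
    spor (closure D) b (A `&` closure D).
Proof.
move=> [C Cpor AC].
pose hit n m l a (d : X) := [set z |
  `|d - z| < qrad a /\ forall y, C n y -> ~ `|z - y| < eps (m + l)].
exists (fun k xs => if unpickle k is Some (n, m, l, a) then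
  xget 0 (hit n m l a (head 0 xs)) else 0) => D clD.
exists (fun n => C n `&` closure D); last first.
  by move=> x [Ax Dx]; have [n _ Cx] := AC x Ax; exists n.
move=> n x [Cx Dx]; apply: por_hole (Cpor n x Cx) => m l [z _ [xz zC]].
have [d [a [Dd dz dx]]] := closure_rad_ball Dx xz.
have hz : hit n m l a d z by [].
have := clD (pickle (n, m, l, a)) [:: d]; rewrite pickleK /=.
case: xgetP => [z' _ [dz' z'C] Dz'|/(_ z)//]; exists z'.
  by apply/subset_closure/Dz' => x'; rewrite inE => /eqP ->.
by split=> [|y [Cy _]]; [exact: dx|exact: z'C].
Qed.

End reflection.

(** * Foran's lemma: failure of sigma-porosity descends to a closure *)

Section foran.
Variables (R : realType) (X : completeNormedModType R) (b : bool).
Variables (A : set X) (F : seq nat -> set X).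
Hypothesis F_closed : forall s, closed (F s).
Hypothesis A_F : A = \bigcup_(u in [set: nat -> nat]) \bigcap_n F (mkseq u n.+1).
Hypothesis A_spor : ~ spor setT b A.

Definition suslin_part (s : seq nat) : set X :=
  \bigcup_(u in [set u | mkseq u (size s) = s]) \bigcap_n F (mkseq u n.+1).

Lemma suslin_part_rcons s :
  suslin_part s `<=` \bigcup_k suslin_part (rcons s k).
Proof.
move=> x [u /= us uF]; exists (u (size s)) => //; exists u => //=.
by rewrite size_rcons mkseqS us.
Qed.

Lemma suslin_part_sub n s : size s = n.+1 -> suslin_part s `<=` F s.
Proof. by move=> sn x [u /=]; rewrite sn => <- /(_ n); apply. Qed.

(* The sets cut out so far, a finite branch of the Suslin scheme, and the
   current set. *)
Definition position := (seq (set X) * seq nat * set X)%type.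
Definition history (p : position) := p.1.1.
Definition branch (p : position) := p.1.2.
Definition core (p : position) := p.2.

Definition good (p : position) :=
  [/\ nowhere_spor setT b (core p), core p `<=` suslin_part (branch p) &
      forall l x, (l < size (history p))%N -> core p x ->
        ~ por setT b (nth set0 (history p) l) x].

Definition cut (p : position) (d : X) (a : nat) : set X :=
  core p `&` [set y | `|d - y| < qrad a].

(** A move answers the ball of centre [d] and radius [qrad a]. The last clause puts the new core
    into closed sets, so that nonporosity survives at limits of points of the cores. *)
Definition move_spec (p : position) d a (p' : position) :=
  [/\ good p', core p' !=set0, core p' `<=` cut p d a,
      history p' = rcons (history p) (cut p d a) /\
      (exists k, branch p' = rcons (branch p) k) &
      forall l, (l < size (history p'))%N -> exists j,
        core p' `<=` solid setT b (size (history p)) j (nth set0 (history p') l)].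

(** For each [H] in the list the sets [solid setT b n j H], [j] varying, cover [E], so one of them
    cuts out of [E] a set that is not sigma-porous. *)
Lemma solid_pieces n (Hs : seq (set X)) (E : set X) : ~ spor setT b E ->
  (forall l x, (l < size Hs)%N -> E x -> ~ por setT b (nth set0 Hs l) x) ->
  exists E', [/\ E' `<=` E, ~ spor setT b E' &
    forall l, (l < size Hs)%N -> exists j, E' `<=` solid setT b n j (nth set0 Hs l)].
Proof.
elim: Hs E => [|H Hs IH] E nE HE; first by exists E; split.
have [||j nEj] := @spor_bigcupN _ _ setT b _ (fun j => solid setT b n j H) E.
- move=> x Ex; have /not_porP/(_ n)[j hj] := HE 0%N x isT Ex; by exists j.
- exact: nE.
have [|E' [E'E nE' E'Hs]] := IH _ nEj; first by move=> l x lHs [Ex _]; exact: (HE l.+1).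
exists E'; split=> // [x /E'E[]//|[_|l lHs]]; last exact: E'Hs.
by exists j => x /E'E[].
Qed.

Lemma move_exists p d a : good p -> cut p d a !=set0 -> exists p', move_spec p d a p'.
Proof.
move=> [p_nsp p_sus p_hist] cut0; set T := cut p d a in cut0 *.
have nT : ~ spor setT b T := p_nsp _ _ cut0.
(* The points of [T] at which [T] is porous form a porous set, so discarding them keeps the rest not
   sigma-porous. *)
pose T1 := T `&` [set x | ~ por setT b T x].
have nT1 : ~ spor setT b T1.
  move=> sT1; apply: nT; apply: (@spor_sub _ _ _ _ _ (T1 `|` T `&` [set x | por setT b T x])).
    by move=> x Tx; have [h|h] := pselect (por setT b T x); [right|left].
  apply: spor_setU => //; apply: spor_por => x [_]; apply: por_sub.
  by move=> y [].
have [||k nT2] := @spor_bigcupN _ _ setT b _ (fun k => suslin_part (rcons (branch p) k)) T1.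
- by move=> x [[/p_sus/suslin_part_rcons]].
- exact: nT1.
set T2 := T1 `&` _ in nT2.
have T2_hist l x : (l < size (rcons (history p) T))%N -> T2 x ->
    ~ por setT b (nth set0 (rcons (history p) T) l) x.
  rewrite size_rcons ltnS nth_rcons leq_eqVlt => /orP[/eqP->|lH] [[Tx nx] _].
    by rewrite ltnn eqxx.
  by rewrite lH; apply: p_hist => //; case: Tx.
have [T3 [T32 nT3 T3s]] := solid_pieces (size (history p)) nT2 T2_hist.
have K3 := @spor_kernel_sub _ _ setT b T3.
exists (rcons (history p) T, rcons (branch p) k, spor_kernel setT b T3); split=> //=.
- split=> //=; first exact: spor_kernel_nowhere_spor.
    by move=> x /K3/T32[].
  by move=> l x lH /K3/T32; exact: T2_hist.
- exact: spor_kernel_neq0.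
- by move=> x /K3/T32[[]].
- by split=> //; exists k.
- by move=> l /T3s[j hj]; exists j => x /K3/hj.
Qed.

Definition start : position := ([::], [::], spor_kernel setT b A).

Lemma good_start : good start.
Proof.
split=> //=; first exact: spor_kernel_nowhere_spor.
by move=> x /spor_kernel_sub; rewrite A_F => -[u _ uF]; exists u.
Qed.

(** Against a given cover by porous sets [C n], a play is built whose balls shrink to a point of [A]
    in the closure of [D] that no [C n] can contain. *)
Lemma spor_transfer : exists Phi, forall D, D !=set0 -> closed_under Phi D ->
  ~ spor (closure D) b (A `&` closure D).
Proof.
have /choice[mv mvP] : forall t : position * X * nat, exists p',
    good t.1.1 -> cut t.1.1 t.1.2 t.2 !=set0 -> move_spec t.1.1 t.1.2 t.2 p'.
  move=> [[p d] a] /=; have [[gp ne]|/not_andP h] :=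
    pselect (good p /\ cut p d a !=set0).
    by have [p' p'P] := move_exists gp ne; exists p'.
  by exists start; case: h.
pose play (w : seq (X * nat)) := foldl (fun p m => mv (p, m.1, m.2)) start w.
(* [Phi] picks a point of a cut inside a coded ball; the position is replayed from the centres [ds]
   and the radius codes [ns]. *)
exists (fun k xs => if (unpickle k, xs) is (Some (ns, a, a'), [:: d, d' & ds])
  then xget 0 (cut (play (zip ds ns)) d a `&` [set y | `|d' - y| < qrad a'])
  else 0) => D [d0 Dd0] clD [C Cpor AC].
pose reach p := exists2 w, (forall x, x \in unzip1 w -> D x) & p = play w.
have reach_mv p d a : reach p -> D d -> reach (mv (p, d, a)).
  move=> [w Dw ->] Dd; exists (rcons w (d, a)); last by rewrite /play -cats1 foldl_cat.
  by move=> x; rewrite /unzip1 map_rcons mem_rcons inE => /predU1P[->|/Dw].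
have reach_meet p d a d' a' y : reach p -> D d -> D d' -> cut p d a y ->
    `|d' - y| < qrad a' -> exists y', [/\ D y', cut p d a y' & `|d' - y'| < qrad a'].
  move=> [w Dw ->] Dd Dd' cy d'y.
  have := clD (pickle (unzip2 w, a, a')) [:: d, d' & unzip1 w].
  rewrite pickleK /= zip_unzip.
  case: xgetP => [y' _ [cy' d'y'] Dy'|/(_ y)[]//]; exists y'; split=> //.
  by apply: Dy' => x; rewrite !inE => /or3P[/eqP->|/eqP->|/Dw].
have DV : D `<=` closure D := @subset_closure _ D.
(* A ball centred in the closure of [D] that meets a cut also meets it in a point of [D], so holes
   in the trace of a cut are holes in the cut. *)
have hole_reflect p e q m k x : reach p -> D e ->
    hole (closure D) m k (cut p e q `&` closure D) x -> hole setT m k (cut p e q) x.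
  move=> rp De [z Vz [xz zT]]; exists z => //; split=> // y Ty zy.
  have [d [a [Dd dy dP]]] := closure_rad_ball Vz zy.
  have [y' [Dy' Ty' dy']] := reach_meet _ _ _ _ _ _ rp De Dd Ty dy.
  by apply: (zT y'); [split=> //; exact: DV|exact: dP].
pose inv n (t : position * X * nat) := [/\ reach t.1.1 /\ good t.1.1,
  size (history t.1.1) = n, D t.1.2 & cut t.1.1 t.1.2 t.2 !=set0].
pose spec n (t t' : position * X * nat) (m : X * nat) :=
  [/\ D m.1, move_spec t.1.1 m.1 m.2 t'.1.1,
      (forall y, C n y -> ~ `|m.1 - y| < qrad m.2) \/
        cut t.1.1 m.1 m.2 `&` closure D `<=` closure (C n),
      (forall y, `|m.1 - y| < qrad m.2 -> `|t.1.2 - y| < qrad t.2) /\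
        (forall y, `|t'.1.2 - y| <= qrad t'.2 -> `|m.1 - y| < qrad m.2) &
      0 <= (qrad t'.2 : R) <= eps n].
have round n t : inv n t -> exists t', inv n.+1 t' /\ exists m, spec n t t' m.
  case: t => -[p d] a [/= [rp gp] sp Dd p0].
  have [e [q [De e0 eC ed]]] : exists e q, [/\ D e, cut p e q !=set0,
      (forall y, C n y -> ~ `|e - y| < qrad q) \/
        cut p e q `&` closure D `<=` closure (C n) &
      (forall y, `|e - y| < qrad q -> `|d - y| < qrad a)].
    (* Either some ball inside the present one meets the core and misses [C n], and it is played, or
       the present ball is kept and [C n] is dense in the trace of its cut. *)
    have [[e [q [De e0 ed eC]]]|av] := pselect (exists e q, [/\ D e, cut p e q !=set0,
      (forall y, `|e - y| < qrad q -> `|d - y| < qrad a) &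
      (forall y, C n y -> ~ `|e - y| < qrad q)]).
      by exists e, q; split=> //; left.
    exists d, a; split=> //; right=> y [[py dy] Vy]; apply/closure_normP => r r0.
    apply: contrapT => /forall2NP yC; apply: av.
    pose r' := Num.min r (qrad a - `|d - y|).
    have r'0 : 0 < r' by rewrite lt_min r0 subr_gt0.
    have [|e [q [De ey eP]]] := @closure_rad_ball _ _ D y y r' Vy.
      by rewrite subrr normr0.
    exists e, q; split=> //; first by exists y.
      move=> z /eP; rewrite lt_min => /andP[_]; have := ler_distD y d z; lra.
    by move=> z Cz /eP; rewrite lt_min => /andP[yz _]; case: (yC z).
  have mvp := mvP (p, e, q) gp e0; set p' := mv _ in mvp.
  have rp' : reach p' by exact: reach_mv.
  have [gp' [y p'y] p'T [hp' [k bp']] _] := mvp.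
  have [_ ey] := p'T y p'y.
  have [y' [Dy' [p'y' _] /= ey']] := reach_meet p' e q e q y rp' De De (conj p'y ey) ey.
  (* The radius is below [eps n] for convergence, and small enough for the closed ball to stay
     inside the ball just played. *)
  have [|a' /andP[a'0]] := @qrad_dense R 0 (Num.min (eps n) (qrad q - `|e - y'|)).
    by rewrite lt_min eps_gt0 subr_gt0.
  rewrite lt_min => /andP[a'n a'q].
  exists (p', y', a'); split.
    split=> //=; first by rewrite hp' size_rcons sp.
    by exists y'; split=> //=; rewrite subrr normr0.
  exists (e, q); split=> //=; last by rewrite (ltW a'0) ltW.
  split=> //; by move=> z y'z; have := ler_distD y' e z; lra.
have /choice[g gP] : forall nt : nat * (position * X * nat), exists t',
    inv nt.1 nt.2 -> inv nt.1.+1 t' /\ exists m, spec nt.1 nt.2 t' m.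
  move=> [n t]; have [it|nit] := pselect (inv n t); last by exists t.
  by have [t' t'P] := round n t it; exists t'.
have [a0 a0P] : exists a, cut start d0 a !=set0.
  have [y Ky] := spor_kernel_neq0 A_spor.
  have [|a /andP[ya _]] := @qrad_dense R `|d0 - y| (`|d0 - y| + 1); first lra.
  by exists a, y.
pose t := fix t n := if n is n'.+1 then g (n', t n') else (start, d0, a0).
have tinv n : inv n (t n).
  elim: n => [|n IH]; last by have [] := gP (n, t n) IH.
  split=> //=; split; last exact: good_start.
  by exists [::].
have /choice[m mP] : forall n, exists m, spec n (t n) (t n.+1) m.
  by move=> n; have [] := gP (n, t n) (tinv n).
pose P n := (t n).1.1; pose T n := cut (P n) (m n).1 (m n).2.
have histE n : history (P n) = mkseq T n.
  elim: n => // n IH; have [_ [_ _ _ [-> _] _] _ _ _] := mP n.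
  by rewrite mkseqS -IH.
have coreS n : core (P n.+1) `<=` core (P n).
  by have [_ [_ _ h _ _] _ _ _] := mP n; move=> x /h[].
have core_le n n' : (n <= n')%N -> core (P n') `<=` core (P n).
  by move=> /subnK <-; elim: (n' - n)%N => // i IH x /coreS/IH.
pose u n := last 0%N (branch (P n.+1)).
have branchE n : branch (P n) = mkseq u n.
  elim: n => // n IH; have [_ [_ _ _ [_ [k kE]] _] _ _ _] := mP n.
  by rewrite mkseqS /u kE last_rcons IH.
(* The indices are shifted by one because the radius of the initial ball need not be at most
   [eps 0]. *)
have [||x xP] := @nested_balls R X (fun n => (t n.+1).1.2) (fun n => qrad (t n.+1).2).
- by move=> n; have [] := mP n.
- move=> n y yn; have [_ _ _ [h h'] _] := mP n.+1.
  by apply/ltW/h/h'.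
have x_core n : closure (core (P n)) x.
  apply/closure_normP => r r0; have [k kr] : exists k, eps k < r / 2.
    by apply: eps_small; lra.
  have [_ _ _ [y [yP /= yb]]] := tinv (maxn n k).+1.
  exists y; first by apply: core_le yP; rewrite leqW// leq_maxl.
  have := xP (maxn n k); have [_ _ _ _ /andP[_]] := mP (maxn n k).
  have := @eps_le R _ _ (leq_maxr n k).
  by have := ler_distD (t (maxn n k).+1).1.2 x y; rewrite (distrC x (t _).1.2); lra.
have Vx : closure D x.
  apply/closure_normP => r r0; have [k kr] := eps_small r0.
  exists (t k.+1).1.2; first by have [] := tinv k.+1.
  by rewrite distrC; have := xP k; have [_ _ _ _ /andP[_]] := mP k; lra.
have Ax : A x.
  rewrite A_F; exists u => // n _; rewrite (iffLR (closure_id _) (@F_closed _)).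
  apply: closureS (x_core n.+1) => y yP; rewrite -branchE.
  have [[_ [_ h _]] _ _ _] := tinv n.+1; apply: (@suslin_part_sub n); last exact: h.
  by rewrite branchE size_mkseq.
have [n _ Cx] := AC x (conj Ax Vx).
have [De _ [avoid [_ h] _|dense _ _]] := mP n.
  by apply: (avoid x Cx); exact/h/xP.
have [[rP _] _ _ _] := tinv n.
(* Porosity of [C n] at [x] in the closure of [D] passes to the trace of [T n], which lies in the
   closure of [C n], and from there to [T n] in [X]. *)
have porT : por setT b (T n) x.
  apply: por_hole (Cpor n x Cx) => i k [z Vz [xz zC]].
  apply: hole_reflect => //; exists z => //; split=> // y /dense/closure_normP Cy zy.
  have [|w Cw yw] := Cy (eps (i + k) - `|z - y|); first by rewrite subr_gt0.
  by apply: (zC w Cw); have := ler_distD y z w; lra.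
apply: (iffRL (@not_porP _ _ setT b (T n) x) _ porT) => i.
(* Move [maxn i n] is late enough for [T n] to be in the resulting history and for the first index
   of [solid] to reach [i]. *)
have [_ [_ _ _ _ solidT] _ _ _] := mP (maxn i n).
have [|j] := solidT n; first by rewrite histE size_mkseq ltnS leq_maxr.
rewrite !histE size_mkseq nth_mkseq ?ltnS ?leq_maxr// => Tj.
exists j; apply: (@solid_mono _ _ setT b i (maxn i n) j _ _ (leq_maxl _ _) (@subset_refl _ _)).
rewrite (iffLR (closure_id _) (@solid_closed _ _ _ _ _ _ _)).
exact: (closureS Tj) (x_core _).
Qed.

End foran.

(** * Closing off under countably many finitary operations *)

Section closing_off.
Variables (T : choiceType) (e : nat -> T) (Phi : nat -> nat -> seq T -> T).

(** The closed-off set consists of the values of finite terms, and these form a countable type; a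
    node label codes an operation and its parameter. *)
Fixpoint eval_tree (t : GenTree.tree nat) : T :=
  match t with
  | GenTree.Leaf i => e i
  | GenTree.Node k ts =>
      if unpickle k is Some (i, j) then Phi i j (map eval_tree ts) else e 0%N
  end.

Lemma eval_tree_closed i : closed_under (Phi i) (range eval_tree).
Proof.
move=> j xs xsP; suff [ts <-] : exists ts, map eval_tree ts = xs.
  by exists (GenTree.Node (pickle (i, j)) ts) => //=; rewrite pickleK.
elim: xs xsP => [|x xs IH] xsP; first by exists [::].
have [|ts <-] := IH; first by move=> y yxs; apply: xsP; rewrite inE yxs orbT.
by have [t _ <-] := xsP x (mem_head _ _); exists (t :: ts).
Qed.

Lemma countable_closure : exists D : set T,
  [/\ countable D, range e `<=` D & forall i, closed_under (Phi i) D].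
Proof.
exists (range eval_tree); split; last exact: eval_tree_closed.
  exact: (sub_countable (card_image_le _ _) (countableP _)).
by move=> _ [i _ <-]; exists (GenTree.Leaf i).
Qed.

End closing_off.

(** * Linearity and separability of the closure *)

Section linear_closure.
Variables (R : realType) (X : normedModType R).

Definition qcomb (k : nat) (xs : seq X) : X := qrad k *: head 0 xs + last 0 xs.

Lemma submod_closed_closure (D : set X) :
  D !=set0 -> closed_under qcomb D -> GRing.submod_closed (mem (closure D)).
Proof.
move=> [d0 Dd0] Dcomb.
have lin a u v : closure D u -> closure D v -> closure D (a *: u + v).
  move=> /closure_normP Du /closure_normP Dv; apply/closure_normP => r r0.
  have u0 : 0 < `|u| + 1 by rewrite ltr_wpDl.
  have a0 : 0 < `|a| + 1 by rewrite ltr_wpDl.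
  (* The first bound, 1, keeps the rational coefficient below [|a| + 1] in norm; the second limits
     the error on [u] to [r / 3]. *)
  have [|k] := @qrad_dense R a (a + Num.min 1 (r / 3 / (`|u| + 1))).
    by rewrite ltrDl lt_min ltr01 !divr_gt0.
  rewrite -ltrBlDl lt_min => /andP[ak /andP[k1 kr]].
  have [|x Dx ux] := Du (r / 3 / (`|a| + 1)); first by rewrite !divr_gt0.
  have [|y Dy vy] := Dv (r / 3); first by rewrite divr_gt0.
  exists (qrad k *: x + y).
    by apply: (Dcomb k [:: x; y]) => z; rewrite !inE => /orP[]/eqP->.
  have -> : a *: u + v - (qrad k *: x + y) =
      (a - qrad k) *: u + qrad k *: (u - x) + (v - y).
    by rewrite scalerBl scalerBr subrKA opprD addrACA.
  have k_le : `|qrad k : R| <= `|a| + 1.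
    rewrite -[X in `|X|](subrK a) addrC (le_trans (ler_normD _ _))// lerD2l.
    by rewrite gtr0_norm ?subr_gt0//; exact: ltW.
  have E1 : `|(a - qrad k) *: u| <= r / 3.
    rewrite normrZ distrC gtr0_norm ?subr_gt0//.
    rewrite -[leRHS](divfK (lt0r_neq0 u0)) ler_pM ?lerDl//.
      by rewrite subr_ge0 ltW.
    exact: ltW.
  have E2 : `|qrad k *: (u - x)| <= r / 3.
    rewrite normrZ mulrC -[leRHS](divfK (lt0r_neq0 a0)) ler_pM//.
    exact: ltW.
  have := ler_normD ((a - qrad k) *: u + qrad k *: (u - x)) (v - y).
  have := ler_normD ((a - qrad k) *: u) (qrad k *: (u - x)).
  lra.
split=> [|a u v /set_mem Du /set_mem Dv]; last exact/mem_set/lin.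
apply/mem_set; have -> : 0 = (-1 : R) *: d0 + d0 by rewrite scaleN1r addNr.
by apply: lin; exact: subset_closure.
Qed.

End linear_closure.

Lemma separable_sub_closure (T : topologicalType) (V : set T) :
  separable (set_type V) -> V !=set0 ->
  exists e : nat -> T, V `<=` closure (range e).
Proof.
move=> [D Dc Dd] [v0 Vv0].
pose v : set_type V := SigSub (mem_set Vv0).
have meetD (W : set T) (w : set_type V) : nbhs (set_val w) W ->
    exists2 d, D d & W (set_val d).
  rewrite nbhsE; case=> O [Oo Ow] OW.
  have [||d [Od Dd']] := Dd ((@set_val T V) @^-1` O).
  - by exists w.
  - by apply: open_comp => // x _; exact: initial_continuous.
  - by exists d => //; exact: OW.
have [d0 Dd0 _] := meetD setT v filterT.
have [h hinj] := countable_injP _ Dc.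
exists (fun i => set_val (xget d0 [set d | D d /\ h d = i])).
move=> w Vw W /= wW; have [d Dd' Wd] := meetD W (SigSub (mem_set Vw)) wW.
exists (set_val d); split=> //; exists (h d) => //; congr set_val.
case: xgetP => [d' _ [Dd1 /hinj hd]|/(_ d)[]//].
by apply: hd; rewrite in_setE.
Qed.

Lemma separable_closure (R : realType) (X : normedModType R) (D : set X) :
  countable D -> separable (set_type (closure D)).
Proof.
move=> Dc; exists (set_val @^-1` D).
  have /countable_injP[h hinj] := Dc; apply/countable_injP.
  exists (h \o set_val) => x y /set_mem Dx /set_mem Dy /= hxy.
  by apply: val_inj; apply: hinj => //; exact: mem_set.
move=> O [x Ox] [P Po PO]; rewrite -PO in Ox *.
have [y [Dy Py]] := set_mem (valP x) P (open_nbhs_nbhs (conj Po Ox)).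
by exists (SigSub (mem_set (subset_closure Dy))).
Qed.

(** * The separable reduction *)

(** The choice of [Phi] depends on [A]: it yields centres of holes if [A] is sigma-porous and points
    of cuts otherwise. *)
Lemma spor_separable_reduction (R : realType) (X : completeNormedModType R)
    (A : set X) b : suslin A ->
  exists Phi, forall D, D !=set0 -> closed_under Phi D ->
    spor setT b A <-> spor (closure D) b (A `&` closure D).
Proof.
move=> [F Fc AF]; have [sA|nA] := pselect (spor setT b A).
  by have [Phi PhiP] := spor_reflection sA; exists Phi => D _ /PhiP.
have [Phi PhiP] := spor_transfer Fc AF nA; exists Phi => D D0 /(PhiP D D0) nAD.
by split.
Qed.

Theorem theorem1p1 (R : realType) (X : completeNormedModType R) (A : set X)
    (hA : suslin A) (V0 : set X) (hV0 : GRing.submod_closed (mem V0))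
    (sepV0 : separable (set_type V0)) :
  exists V : set X,
    [/\ GRing.submod_closed (mem V), closed V, separable (set_type V),
        V0 `<=` V &
        (sigma_upper_porous A <->
           sigma_upper_porous ((@set_val X V) @^-1` A)) /\
        (sigma_lower_porous A <->
           sigma_lower_porous ((@set_val X V) @^-1` A))].
Proof.
have V00 : V0 !=set0 by exists 0; apply/set_mem; case: hV0.
have [e V0e] := separable_sub_closure sepV0 V00.
have [Phiu PhiuP] := spor_separable_reduction true hA.
have [Phil PhilP] := spor_separable_reduction false hA.
(* Indices 0 and 1 serve the two porosities; from 2 on [nth] returns its default [qcomb], which
   makes the closure a subspace. *)
have [D [Dc eD Dcl]] := countable_closure e (nth (@qcomb R X) [:: Phiu; Phil]).
have D0 : D !=set0 by exists (e 0%N); apply: eD; exists 0%N.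
exists (closure D); split.
- exact: submod_closed_closure (Dcl 2%N).
- exact: closed_closure.
- exact: separable_closure.
- exact: subset_trans V0e (closureS eD).
have id_ball (x : X) r w : ball x r w <-> `|id x - id w| < r.
  by rewrite -ball_normE.
have val_ball (x : set_type (closure D)) r w :
    ball x r w <-> `|set_val x - set_val w| < r.
  by rewrite set_type_ballE.
have rval : range (@set_val X (closure D)) = closure D.
  apply/seteqP; split=> [_ [x _ <-]|x Dx]; first exact/set_mem/valP.
  by exists (SigSub (mem_set Dx)).
have valA : (@set_val X (closure D)) @` (set_val @^-1` A) = A `&` closure D.
  apply/seteqP; split=> [_ [x Ax <-]|x [Ax Dx]].
    by split=> //; exact/set_mem/valP.
  by exists (SigSub (mem_set Dx)).
split.
  rewrite (sigma_upper_porousP id_ball) (sigma_upper_porousP val_ball).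
  by rewrite !image_id rval valA; exact: PhiuP (Dcl 0%N).
rewrite (sigma_lower_porousP id_ball) (sigma_lower_porousP val_ball).
by rewrite !image_id rval valA; exact: PhilP (Dcl 1%N).
Qed.
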